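(* Let $V$ be a (real) topological vector space, let $U \subseteq V$ be a convex set, and let $\phi : U \to \mathbb{R}$ be a convex function. Let $a, b, c \in U$ be three aligned points such that $a+b-c \in U$ and $c \notin [a,b]$. Then $$\phi(a)+\phi(b) \leq \phi(c)+\phi(a+b-c).$$
   Context: Points are aligned if they lie on a common (affine) line. For $a,b \in V$, $[a,b] = \{(1-\lambda)a + \lambda b : 0 \leq \lambda \leq 1\}$ denotes the closed segment joining $a$ and $b$. A function $\phi : U \to \mathbb{R}$ on a convex set $U$ is convex if $\phi(\lambda x + (1-\lambda) y) \leq \lambda \phi(x) + (1-\lambda)\phi(y)$ for all $x,y \in U$ and $0 \leq \lambda \leq 1$. *)

(* Defs.v *)
From mathcomp Require Import all_boot all_order all_algebra.
From mathcomp Require Import all_classical all_reals all_analysis.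

Set Implicit Arguments.
Unset Strict Implicit.
Unset Printing Implicit Defensive.

Import Order.TTheory GRing.Theory Num.Theory.

Local Open Scope classical_set_scope.
Local Open Scope ring_scope.

Definition affine_line (R : realType) (V : lmodType R) (p d : V) : set V :=
  [set p + t *: d | t in [set: R]].

(* The direction is required to be nonzero, so that the set is a genuine line
   and not a single point. *)
Definition aligned (R : realType) (V : lmodType R) (A : set V) : Prop :=
  exists p d : V, d != 0 /\ A `<=` affine_line p d.

Definition closed_segment (R : realType) (V : lmodType R) (a b : V) : set V :=
  [set (1 - l) *: a + l *: b | l in `[0, 1]].

(* Main.v *)
(* On the line through [a], [b], [c], the point [c] lies strictly outside
   [a, b], so both [a] and [b] lie on the segment from [c] to [a + b - c],
   symmetrically about its midpoint: [a] is the convex combination with weights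
   (l, 1 - l) and [b] the one with weights (1 - l, l). Adding the two convexity
   inequalities gives the result. *)
Require Import Defs.
From mathcomp Require Import all_boot all_order all_algebra.
From mathcomp Require Import all_classical all_reals all_analysis.
From mathcomp Require Import ring lra.
Import Order.TTheory GRing.Theory Num.Theory.
Local Open Scope classical_set_scope.
Local Open Scope ring_scope.

Lemma convex_function_le (R : realType) (V : lmodType R) (U : set V)
    (phi : V -> R) (x y : V) (l : R) :
  convex_function U phi -> x \in U -> y \in U -> 0 <= l -> l <= 1 ->
  phi (l *: x + (1 - l) *: y) <= l * phi x + (1 - l) * phi y.
Proof. by move=> phiU xU yU l0 l1; exact: (phiU (Itv01 l0 l1) x y xU yU). Qed.

Lemma convex_function_symmetric_le (R : realType) (V : lmodType R)
    (U : set V) (phi : V -> R) (x y : V) (l : R) :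
  convex_function U phi -> x \in U -> y \in U -> 0 <= l -> l <= 1 ->
  phi (l *: x + (1 - l) *: y) + phi ((1 - l) *: x + l *: y) <= phi x + phi y.
Proof.
move=> phiU xU yU l0 l1.
have xy := convex_function_le _ _ _ _ _ _ _ phiU xU yU l0 l1.
have yx := convex_function_le _ _ _ _ _ _ _ phiU yU xU l0 l1.
rewrite [X in phi X <= _]addrC in yx.
lra.
Qed.

(** By contraposition: a nonpositive product puts [u] between [s] and [t]. The product says that [s]
    and [t] lie on the same side of [u] without fixing their order. *)
Lemma notin_closed_segment_line (R : realType) (V : lmodType R) (p d : V)
    (s t u : R) :
  p + u *: d \notin closed_segment (p + s *: d) (p + t *: d) ->
  0 < (s - u) * (t - u).
Proof.
rewrite ltNge; apply: contra => sut; apply/mem_set.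
suff [l l01 lE] : exists2 l : R, l \in `[0, 1] & u = (1 - l) * s + l * t.
  exists l => //.
  by rewrite !scalerDr !scalerA addrACA -!scalerDl subrK scale1r -lE.
(* If [t = s], the product is a square, which forces [u = s]. *)
have [ts|ts] := eqVneq t s.
  exists 0; first by rewrite in_itv/= lexx ler01.
  have : (s - u) ^+ 2 <= 0 by rewrite expr2 -{2}ts.
  by rewrite subr0 mul1r mul0r addr0 => ?; apply/eqP; rewrite eq_sym -subr_eq0
    -sqrf_eq0 eq_le sqr_ge0 andbT.
have ts0 : t - s != 0 by rewrite subr_eq0.
exists ((u - s) / (t - s)); last by field.
have ts2 : 0 < (t - s) ^+ 2 by rewrite exprn_even_gt0.
(* The sign of [t - s] is unknown; a squared denominator makes both bounds polynomial
   inequalities. *)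
have -> : (u - s) / (t - s) = (u - s) * (t - s) / (t - s) ^+ 2 by field.
by rewrite in_itv/= ler_pdivlMr// ler_pdivrMr// mul0r mul1r; nra.
Qed.

Theorem theorem4p1 (R : realType) (V : topologicalLmodType R)
    (U : set V) (phi : V -> R) (a b c : V) :
  convex_set U -> convex_function U phi ->
  a \in U -> b \in U -> c \in U ->
  aligned [set a; b; c] ->
  a + b - c \in U ->
  c \notin closed_segment a b ->
  phi a + phi b <= phi c + phi (a + b - c).
Proof.
move=> _ phiU _ _ cU [p [d [_ line]]] eU cab.
have [s _ aE] : affine_line p d a by apply: line; left; left.
have [t _ bE] : affine_line p d b by apply: line; left; right.
have [u _ cE] : affine_line p d c by apply: line; right.
have stu : 0 < (s - u) * (t - u).
  by apply: (notin_closed_segment_line _ _ p d); rewrite aE bE cE.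
have [s2 t2] := (sqr_ge0 (s - u), sqr_ge0 (t - u)).
(* Expand the square of [(s - u) + (t - u)]: the cross term is positive by [stu]. *)
have n0 : 0 < (s + t - 2 * u) ^+ 2 by nra.
have n_neq0 : s + t - 2 * u != 0.
  by apply: contraTneq n0 => ->; rewrite expr0n ltxx.
(* The solution of [l * u + (1 - l) * (s + t - u) = s], where [s + t - u] is the parameter of
   [a + b - c]. *)
pose l := (t - u) / (s + t - 2 * u).
have lE : l = (t - u) * (s + t - 2 * u) / (s + t - 2 * u) ^+ 2.
  by rewrite /l; field.
have l0 : 0 <= l by rewrite lE ler_pdivlMr// mul0r; nra.
have l1 : l <= 1 by rewrite lE ler_pdivrMr// mul1r; nra.
have eE : a + b - c = p + (s + t - u) *: d.
  rewrite -aE -bE -cE opprD addrACA [p + _]addrC addrK scalerBl scalerDl.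
  by rewrite -!addrA addrCA.
have combE k : k *: c + (1 - k) *: (a + b - c) =
    p + (k * u + (1 - k) * (s + t - u)) *: d.
  by rewrite eE -cE !scalerDr !scalerA addrACA -!scalerDl [k + _]addrC subrK
    scale1r.
have la : l *: c + (1 - l) *: (a + b - c) = a.
  by rewrite combE -aE; congr (_ + _ *: _); rewrite /l; field.
have lb : (1 - l) *: c + l *: (a + b - c) = b.
  (* Writing the second weight as [1 - (1 - l)] lets [combE] apply with [k := 1 - l]. *)
  rewrite -{2}[l](subKr 1) combE -bE; congr (_ + _ *: _); rewrite /l; field.
  exact: n_neq0.
by have := convex_function_symmetric_le _ _ _ _ _ _ _ phiU cU eU l0 l1; rewrite la lb.
Qed.
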